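(* Let $K_1$ and $K_2$ be compact (Hausdorff) spaces neither of which contains an uncountable metrizable closed subspace. Then $\mathcal C_p(K_1\times K_2)$ does not contain a complemented copy of $\mathcal C_p(L)$ for any uncountable metric compact space $L$.
   Context: For a compact space $K$, $\mathcal C_p(K)$ denotes the vector space of continuous real-valued functions on $K$ with the topology of pointwise convergence. $\mathcal C_p(K)$ contains a complemented copy of a topological vector space $X$ if there are closed linear subspaces $E,F$ of $\mathcal C_p(K)$ with $\mathcal C_p(K)=E\oplus F$ algebraically, such that the canonical projections onto $E$ and $F$ are continuous and $E$ is linearly homeomorphic (isomorphic as a topological vector space) to $X$. *)

(* Defs.v *)
From mathcomp Require Import all_boot all_order all_algebra.
From mathcomp Require Import all_classical all_reals all_analysis.
Unset Implicit Arguments. Unset Printing Implicit Defensive.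
Import Order.TTheory GRing.Theory Num.Theory numFieldNormedType.Exports.
Local Open Scope classical_set_scope.
Local Open Scope ring_scope.

Section Defs.
Variable R : realType.

Definition metrizable_subset (T : topologicalType) (A : set T) : Prop :=
  exists d : T -> T -> R,
    [/\ (forall x y, A x -> A y -> 0 <= d x y),
        (forall x y, A x -> A y -> (d x y = 0 <-> x = y)),
        (forall x y, A x -> A y -> d x y = d y x),
        (forall x y z, A x -> A y -> A z -> d x z <= d x y + d y z) &
        (forall x, A x -> forall U : set T,
            within A (nbhs x) U <->
            exists2 e : R, 0 < e & forall y, A y -> d x y < e -> U y)].

Definition compact_hausdorff (T : topologicalType) : Prop :=
  hausdorff_space T /\ compact [set: T].

Definition has_uncountable_metrizable_closed (T : topologicalType) : Prop :=
  exists A : set T, [/\ closed A, ~ countable A & metrizable_subset T A].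

Definition uncountable_metric_compact (T : topologicalType) : Prop :=
  [/\ metrizable_subset T [set: T], compact [set: T] & ~ countable [set: T]].

Definition Cp (K : topologicalType) : set {ptws K -> R} :=
  [set f : K -> R | continuous f].

Definition linear_subspace (K : Type) (E : set (K -> R)) : Prop :=
  E (fun _ => 0) /\
  forall (a : R) (f g : K -> R), E f -> E g -> E (fun x => a * f x + g x).

Definition closed_in_Cp (K : topologicalType) (E : set {ptws K -> R}) : Prop :=
  exists C : set {ptws K -> R}, closed C /\ E = Cp K `&` C.

Definition lin_homeomorphic_to_Cp (K L : topologicalType)
    (E : set {ptws K -> R}) : Prop :=
  exists (phi : {ptws K -> R} -> {ptws L -> R})
         (psi : {ptws L -> R} -> {ptws K -> R}),
    (forall f, E f -> Cp L (phi f)) /\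
    (forall g, Cp L g -> E (psi g)) /\
    (forall f, E f -> psi (phi f) = f) /\
    (forall g, Cp L g -> phi (psi g) = g) /\
    (forall (a : R) f g, E f -> E g ->
        phi (fun x => a * f x + g x) = (fun y => a * phi f y + phi g y)) /\
    {within E, continuous phi} /\
    {within Cp L, continuous psi}.

(* C_p(K) contains a complemented copy of C_p(L): closed linear subspaces
   E, F of C_p(K) with C_p(K) = E (+) F algebraically, continuous canonical
   projections, and E linearly homeomorphic to C_p(L). The canonical
   projection onto E is the map pE with pE f in E and f - pE f in F
   (unique because E `&` F = {0}); the projection onto F is f - pE f. *)
Definition Cp_contains_complemented_Cp (K L : topologicalType) : Prop :=
  exists (E F : set {ptws K -> R}) (pE pF : {ptws K -> R} -> {ptws K -> R}),
    E `<=` Cp K /\ F `<=` Cp K /\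
    linear_subspace K E /\ linear_subspace K F /\
    closed_in_Cp K E /\ closed_in_Cp K F /\
    E `&` F = [set (fun _ => 0)] /\
    (forall f, Cp K f -> [/\ E (pE f), F (pF f) & f = (fun x => pE f x + pF f x)]) /\
    {within Cp K, continuous pE} /\
    {within Cp K, continuous pF} /\
    lin_homeomorphic_to_Cp K L E.

End Defs.

(* Main.v *)
Require Import Defs.
From mathcomp Require Import all_boot all_order all_algebra.
From mathcomp Require Import all_classical all_reals all_analysis.
From mathcomp Require Import finmap lra.
Import Order.TTheory GRing.Theory Num.Theory numFieldNormedType.Exports.
Local Open Scope classical_set_scope.
Local Open Scope ring_scope.

(** Write [lam y f] for the value at [y] of the image in C_p(L) of the
  projection of [f]. For fixed [y] this functional is continuous on C_p(K),
  K = K1 * K2, hence depends only on the values of [f] on a finite set; let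
  [t y] be such a set of least size. The size of [t y] is lower semicontinuous
  in [y], and around [y0] the points of [t y], for [y] with
  [size (t y) <= size (t y0)], are given by continuous functions of [y].
  On a compact neighbourhood their ranges have metrizable, hence countable,
  projections to K1 and K2, so all these [t y] lie in one countable set.
  Dually, evaluation at a point [p] of K of the embedding of C_p(L) depends
  only on the values on a finite set [r p], and [y] belongs to some [r p] with
  [p] in [t y]. So L is locally countable on each level set of the size, hence
  countable. *)

(** * Urysohn functions and disjoint neighbourhoods *)

Lemma compact_hausdorff_bump (R : realType) (T : topologicalType) (x : T)
    (V : set T) :
  compact_hausdorff T -> nbhs x V ->
  exists f : T -> R,
    [/\ continuous f, forall z, 0 <= f z <= 1, f x = 1 &
      forall z, ~ V z -> f z = 0].
Proof.
move=> [hT cT] xV.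
have crT : completely_regular_space T.
  apply: (@normal_completely_regular R).
    exact: compact_normal.
  exact: hausdorff_accessible.
have clV : closed (~` V°) by apply: open_closedC; exact: open_interior.
have nVx : ~ (~` V°) x by apply; exact: nbhs_singleton (nbhs_interior xV).
have [f [cf f01 f0 f1]] :=
  (uniform_separatorP (R := R) _ _).1 (crT x _ clV nVx).
exists (fun z => 1 - f z); split.
- by move=> z; apply: cvgB; [exact: cvg_cst|exact: cf].
- move=> z; have /f01 : range f (f z) by exists z.
  by rewrite /= in_itv /=; lra.
- by rewrite (f0 (f x)) ?subr0//; exists x.
- move=> z nVz; rewrite (f1 (f z)) ?subrr//; exists z => // Vz.
  by apply: nVz; exact: interior_subset.
Qed.

Lemma hausdorff_disjoint_nbhs (T : topologicalType) (s : seq T) :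
  hausdorff_space T ->
  exists U : T -> set T,
    [/\ forall x, open (U x), forall x, U x x &
        forall x y, x \in s -> y \in s -> U x `&` U y !=set0 -> x = y].
Proof.
rewrite open_hausdorff => hT.
have /choice[AB ABP] : forall xy : T * T, exists AB : set T * set T,
    xy.1 != xy.2 -> [/\ open AB.1, open AB.2, AB.1 xy.1, AB.2 xy.2 &
      AB.1 `&` AB.2 = set0].
  move=> [x y] /=; have [->|xy] := eqVneq x y; first by exists (setT, setT).
  have [AB [/set_mem ? /set_mem ?] [? ? /eqP ?]] := hT _ _ xy.
  by exists AB.
(* The sets chosen for [(x, y)] and for [(y, x)] are unrelated, so [U x] is put inside both of those
   that contain [x]. *)
pose U x := (\bigcap_(y in [set` [fset y in s]%fset])
   [set z | x != y -> ((AB (x, y)).1 `&` (AB (y, x)).2) z])°.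
have UN x : nbhs x (U x).
  apply: nbhs_interior; apply: filter_bigI => y _.
  have [->|xy] := eqVneq x y; first by apply: filterE => z.
  have [oA _ Ax _ _] := ABP (x, y) xy.
  have yx : y != x by rewrite eq_sym.
  have [_ oB _ Bx _] := ABP (y, x) yx.
  have : nbhs x ((AB (x, y)).1 `&` (AB (y, x)).2).
    by apply: filterI; apply: open_nbhs_nbhs.
  by apply: filterS => z + _.
exists U; split.
- by move=> x; exact: open_interior.
- by move=> x; exact: nbhs_singleton.
- move=> x y xs ys [z [/interior_subset Uxz /interior_subset Uyz]].
  apply/eqP/negPn/negP => xy.
  have [z1 _] : ((AB (x, y)).1 `&` (AB (y, x)).2) z.
    by apply: Uxz => //=; rewrite !inE.
  have [_ z2] : ((AB (y, x)).1 `&` (AB (x, y)).2) z.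
    by apply: Uyz; rewrite /= ?inE// eq_sym.
  have [_ _ _ _ AB0] := ABP (x, y) xy.
  by have : set0 z by rewrite -AB0.
Qed.

(** * Metrizable compact spaces and their continuous images *)

Lemma metrizable_hausdorff (R : realType) (T : topologicalType) :
  metrizable_subset R T [set: T] -> hausdorff_space T.
Proof.
move=> [d [d0 deq dC dtri dnbhs]] p q pq; apply/(deq p q I I)/eqP.
apply/negPn/negP => dpq0.
have dpq : 0 < d p q / 2 by rewrite divr_gt0// lt0r dpq0 d0.
have ballN x : nbhs x [set y | d x y < d p q / 2].
  have [_ W] := dnbhs x I [set y | d x y < d p q / 2].
  by rewrite withinET in W; apply: W; exists (d p q / 2).
have [z [/= pz qz]] := pq _ _ (ballN p) (ballN q).
by have := dtri p z q I I I; rewrite (dC z q) //; lra.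
Qed.

Lemma metrizable_compact_second_countable (R : realType)
    (T : topologicalType) :
  metrizable_subset R T [set: T] -> compact [set: T] -> @second_countable T.
Proof.
move=> [d [d0 deq dC dtri dnbhs]] cT.
pose b n x := [set y | d x y < n.+1%:R^-1].
have bN n x : nbhs x (b n x).
  have [_ W] := dnbhs x I (b n x).
  by rewrite withinET in W; apply: W; exists n.+1%:R^-1.
have /choice[s sP] : forall n, exists s : {fset T},
    [set: T] `<=` \bigcup_(x in [set` s]) (b n x)°.
  move=> n.
  (* Finite sets ordered by inclusion generate a filter; along it the near-covering form of
     compactness yields one finite set of centres. *)
  pose F := filter_from [set: {fset T}] (fun s => [set s' | s `<=` s']%fset).
  have FF : Filter F.
    apply: filter_fromT_filter => [|s t]; first by exists fset0.
    by exists (s `|` t)%fset => u /=; rewrite fsubUset => /andP[].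
  have /compact_near_coveringP/(_ _ F
    (fun s z => (\bigcup_(x in [set` s]) (b n x)°) z) FF) := cT.
  case=> [x _|s _ /(_ s (fsubset_refl s)) ?]; last by exists s.
  exists ((b n x)°, [set s | [fset x] `<=` s]%fset).
    by split; [exact: nbhs_interior | exists [fset x]%fset].
  by move=> [z s] [/= xz]; rewrite fsub1set => xs; exists x.
exists (\bigcup_n [set (b n x)° | x in [set` s n]]).
  apply: bigcup_countable => // n _; apply: finite_set_countable.
  exact: finite_image.
split.
  by move=> _ [n _ [x _ <-]]; exact: open_interior.
move=> x U xU.
have [e e0 eU] : exists2 e : R, 0 < e & forall y, d x y < e -> U y.
  have /(dnbhs x I U)[e e0 eU] : within [set: T] (nbhs x) U.
    by apply: filterS xU => y.
  by exists e => // y; exact: eU.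
have [n ne] : exists n, n.+1%:R^-1 < e / 2.
  have e20 : 0 < e / 2 by rewrite divr_gt0.
  have [n _ /(_ n (leqnn n))] := near_infty_natSinv_lt (PosNum e20).
  by exists n.
have [z zs xz] := sP n x I.
exists (b n z)°; last first.
  move=> y /interior_subset; move/interior_subset: xz; rewrite /b /=.
  move: (_^-1) ne => r ne zx zy.
  by apply: eU; have := dtri x z y I I I; rewrite (dC x z) //; lra.
by split => //; exists n => //; exists z.
Qed.

(** The metric is the supremum over [n] of [|f n x - f n y|] divided by [n + 1]. The weights leave
    finitely many terms to control, so balls are neighbourhoods within [A]; compactness of [A] gives
    the converse. *)
Lemma separating_sequence_metrizable (R : realType) (T : topologicalType)
    (A : set T) (f : nat -> T -> R) :
  compact A -> (forall n, continuous (f n)) ->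
  (forall n x, 0 <= f n x <= 1) ->
  (forall x y, A x -> A y -> (forall n, f n x = f n y) -> x = y) ->
  metrizable_subset R T A.
Proof.
move=> cA cf f01 fsep.
pose a x y n := `|f n x - f n y| / n.+1%:R.
have a_le x y n : a x y n <= n.+1%:R^-1.
  rewrite -[leRHS]mul1r ler_wpM2r// ler_norml.
  by have := f01 n x; have := f01 n y; lra.
have a_ge0 x y n : 0 <= a x y n by rewrite divr_ge0.
pose d x y := sup (range (a x y)).
have ad x y n : a x y n <= d x y.
  apply: ub_le_sup; last by exists n.
  exists 1 => _ [m _ <-]; apply: le_trans (a_le x y m) _.
  by rewrite invf_le1// ler1n.
have d_le x y c : (forall n, a x y n <= c) -> d x y <= c.
  move=> ac; apply: ge_sup; first by exists (a x y 0%N), 0%N.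
  by move=> _ [n _ <-].
exists d; split.
- by move=> x y _ _; exact: le_trans (a_ge0 x y 0%N) (ad x y 0%N).
- move=> x y Ax Ay; split=> [dxy|->].
    apply: fsep => // n; apply/eqP; rewrite -subr_eq0 -normr_eq0.
    have := ad x y n; rewrite dxy /a ler_pdivrMr// mul0r => fn.
    by rewrite eq_le fn normr_ge0.
  apply/eqP; rewrite eq_le; apply/andP; split.
    by apply: d_le => n; rewrite /a subrr normr0 mul0r.
  by exact: le_trans (a_ge0 y y 0%N) (ad y y 0%N).
- move=> x y _ _; rewrite /d; suff -> : a x y = a y x by [].
  by apply/funext => n; rewrite /a distrC.
- move=> x y z _ _ _; apply: d_le => n.
  apply: le_trans (lerD (ad x y n) (ad y z n)).
  by rewrite /a -mulrDl ler_wpM2r// ler_distD.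
move=> x Ax U; split=> [xU|[e e0 eU]].
  (* For small positive [e] the implication holds near every [y] in [A]: at [x] because [U] is a
     neighbourhood within [A], elsewhere because some [f n] keeps [d x z] away from 0. *)
  have /compact_near_coveringP/near_covering_withinP/(_ _ (0 : R)^'+
    (fun e y => d x y < e -> U y) _) := cA.
  case.
  - move=> y Ay; have [<-|xy] := eqVneq x y.
      exists ([set y | A y -> U y], setT) => /=.
        by split => //; exact: filterT.
      by move=> [z e] [/= Uz _ Az _]; exact: Uz.
    have [n fn] : exists n, f n x != f n y.
      apply/not_existsP => fxy; move/eqP: xy; apply; apply: fsep => // n.
      by apply/eqP/negPn/negP/fxy.
    pose c := `|f n x - f n y| / 2.
    have c0 : 0 < c by rewrite divr_gt0// normr_gt0 subr_eq0.
    exists ([set z | `|f n y - f n z| < c], [set e | e < c / n.+1%:R]) => /=.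
      split.
        by have /cvgrPdist_lt := cf n y; exact.
      apply: nbhs_right_lt; exact: divr_gt0.
    move=> [z e] [/= fyz ec _ dxz]; exfalso.
    have : c / n.+1%:R <= a x z n.
      rewrite ler_wpM2r//.
      have := ler_distD (f n z) (f n x) (f n y).
      by rewrite (distrC (f n z)) /c in fyz *; lra.
    by rewrite leNgt (le_lt_trans (ad x z n))// (lt_trans dxz).
  - move=> e' /= e'0 e'A; exists (e' / 2) => [|y Ay]; first exact: divr_gt0.
    have e2 : 0 < e' / 2 by exact: divr_gt0.
    apply: (e'A (e' / 2)) => //=.
    by rewrite sub0r normrN gtr0_norm//; lra.
have [N Ne] : exists N, N.+1%:R^-1 < e / 2.
  have e20 : 0 < e / 2 by rewrite divr_gt0.
  have [n _ /(_ n (leqnn n))] := near_infty_natSinv_lt (PosNum e20).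
  by exists n.
(* Terms of index at least [N] are already below [e / 2], so only the first [N] need to be made
   small. *)
have : \forall y \near x, forall n : 'I_N, `|f n x - f n y| < e / 2.
  apply: filter_forall => n.
  by have /cvgrPdist_lt := cf n x; apply; rewrite divr_gt0.
rewrite /within /=; apply: filterS => y fxy Ay; apply: eU => //.
apply: (@le_lt_trans _ _ (e / 2)); last by lra.
apply: d_le => n; have [nN|Nn] := ltnP n N.
  have := fxy (Ordinal nN); rewrite /a /= => /ltW; apply: le_trans.
  by rewrite ler_pdivrMr// ler_peMr// ler1n.
apply: le_trans (a_le x y n) _; apply: le_trans _ (ltW Ne).
by rewrite lef_pV2 ?posrE// ler_nat.
Qed.

(** Serves to turn the assumption on [K1] and [K2] into countability of continuous images of compact
    subsets of [L]. *)
Lemma continuous_image_metrizable (R : realType) (L T : topologicalType)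
    (M : set L) (g : L -> T) :
  @second_countable L -> compact_hausdorff T -> compact M ->
  {within M, continuous g} ->
  closed (g @` M) /\ metrizable_subset R T (g @` M).
Proof.
move=> [B cB [Bo Bb]] chT cM cg.
have cgM : compact (g @` M) by exact: continuous_compact.
split; first by apply: compact_closed cgM; case: chT.
have /countable_injP[code code_inj] : countable (B `*` B) by exact: countableX.
(* For each pair of basic open sets pick one function separating their images:
   countably many functions then separate the points of [g @` M]. *)
pose Q (UV : set L * set L) (h : T -> R) :=
  (forall y, UV.1 y -> M y -> h (g y) <= 3^-1) /\
  (forall y, UV.2 y -> M y -> 1 - 3^-1 <= h (g y)).
pose C (h : T -> R) := continuous h /\ forall x, 0 <= h x <= 1.
have /choice[f fP] : forall n, exists h, C h /\
    forall UV, (B `*` B) UV -> code UV = n ->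
      (exists2 h, C h & Q UV h) -> Q UV h.
  move=> n.
  have [[UV [h [BUV UVn Ch Qh]]]|noUV] := pselect (exists UV h,
      [/\ (B `*` B) UV, code UV = n, C h & Q UV h]).
    exists h; split=> // UV' BUV' UV'n _.
    suff -> : UV' = UV by [].
    by apply: code_inj; [exact: mem_set|exact: mem_set|rewrite UVn].
  (* Default value: no pair with code [n] can be separated, so the condition on [h] is vacuous. *)
  exists (cst 0); split.
    by split=> [|x]; [exact: cst_continuous|rewrite lexx ler01].
  by move=> UV BUV UVn [h Ch Qh]; exfalso; apply: noUV; exists UV, h.
apply: (@separating_sequence_metrizable R T _ f) => //.
- by move=> n; have [[]] := fP n.
- by move=> n; have [[]] := fP n.
move=> _ _ [p Mp <-] [q Mq <-] fpq; apply/eqP/negPn/negP => gpq.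
have [|h [ch h01 hp hq]] :=
    compact_hausdorff_bump R T (g p) (~` [set g q]) chT.
  apply: open_nbhs_nbhs; split; last exact/eqP.
  apply: closed_openC; apply: accessible_closed_set1.
  by apply: hausdorff_accessible; case: chT.
have hgM z r : M z -> 0 < r ->
    exists V, [/\ B V, V z & forall y, V y -> M y -> `|h (g z) - h (g y)| < r].
  move=> Mz r0; have [_ /(_ z)Bz] := conj Bo Bb.
  have /subspace_continuousP/(_ z Mz)gz := cg.
  have /(_ _ (nbhsx_ballx (h (g z)) r r0)) := cvg_comp _ _ gz (ch (g z)).
  move=> hz; have [V [BV Vz] VS] := Bz _ hz.
  by exists V; split => // y Vy My; exact: VS.
(* Since [h] is 1 at [g p] and 0 at [g q], a variation below one third leaves a gap between the
   values near [p] and near [q]. *)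
have r0 : 0 < 3^-1 :> R by rewrite invr_gt0.
have [V [BV Vp hV]] := hgM p _ Mp r0.
have [U [BU Uq hU]] := hgM q _ Mq r0.
have QUV : Q (U, V) h.
  split=> y /= yUV My.
    have := hU y yUV My; rewrite hq; last by apply.
    have /andP[h0 _] := h01 (g y).
    by rewrite sub0r normrN ger0_norm// => /ltW.
  have := hV y yUV My; rewrite hp; move: (_^-1) => r.
  by have := ler_norm (1 - h (g y)); lra.
(* The function picked for [(U, V)] satisfies [Q] because [h] does, and so separates [g p] from
   [g q], against [fpq]. *)
have [_ /(_ (U, V) _ erefl)] := fP (code (U, V)).
case => //; first by exists h.
move=> /(_ q Uq Mq) fq /(_ p Vp Mp); rewrite fpq => fp.
lra.
Qed.

(** * Functionals determined by finitely many points *)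

Definition linear_on_Cp (R : realType) (K : topologicalType)
    (lam : (K -> R) -> R) :=
  forall (a : R) (f g : K -> R), continuous f -> continuous g ->
    lam (fun x => a * f x + g x) = a * lam f + lam g.

(** For linear [lam] this means that, on continuous functions, [lam] is a linear combination of the
    evaluations at the points of [s]. *)
Definition determining (R : realType) (K : topologicalType)
    (lam : (K -> R) -> R) (s : seq K) :=
  forall f : K -> R, continuous f -> {in s, forall x, f x = 0} -> lam f = 0.

Arguments linear_on_Cp {R K}.
Arguments determining {R K}.

Lemma linear_on_Cp0 (R : realType) (K : topologicalType)
    (lam : (K -> R) -> R) :
  linear_on_Cp lam -> lam (fun=> 0) = 0.
Proof.
move=> lin; have c0 : continuous (fun _ : K => 0 : R) by exact: cst_continuous.
have := lin 1 _ _ c0 c0; rewrite /= mulr0 addr0; lra.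
Qed.

Lemma continuous_determining (R : realType) (K L : topologicalType)
    (Phi : {ptws K -> R} -> {ptws L -> R}) :
  {within Cp R K, continuous Phi} ->
  (forall y, linear_on_Cp (fun f : K -> R => Phi f y)) ->
  forall y, exists s, determining (fun f : K -> R => Phi f y) s.
Proof.
move=> cPhi lin y.
have c0 : continuous (fun _ : K => 0 : R) by exact: cst_continuous.
(* The functions vanishing on finite sets generate a filter converging pointwise
   to 0, so every neighbourhood of 0 contains all functions vanishing on some
   finite set. *)
pose F : set_system (K -> R) := filter_from [set: seq K]
  (fun s => [set f | {in s, forall x, f x = 0}]).
have FF : Filter F.
  apply: filter_fromT_filter => [|s t]; first by exists [::].
  exists (s ++ t) => f /= f0.
  by split=> x xs; apply: f0; rewrite mem_cat xs ?orbT.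
have F0 : {ptws, F --> (fun=> 0 : R)}.
  apply/(@pointwise_cvgP K R) => x; apply/cvgrPdist_lt => e e0.
  exists [:: x] => // f /= /(_ x (mem_head _ _)) ->.
  by rewrite subrr normr0.
have Phi00 : Phi (fun=> 0) y = 0 := linear_on_Cp0 R K _ (lin y).
have /subspace_continuousP/(_ (fun=> 0) c0) := cPhi.
move/(cvg_comp _ _)/(_ (@proj_continuous L (fun=> R) y _)).
move=> /cvgrPdist_lt/(_ 1 ltr01)/F0[s _ sPhi'].
have sPhi f : {in s, forall x, f x = 0} -> continuous f -> `|Phi f y| < 1.
  move=> f0 cf; have := sPhi' f f0 cf.
  by rewrite /proj /from_subspace /= Phi00 sub0r normrN.
exists s => f cf f0; apply/eqP.
rewrite -normr_le0 leNgt; apply/negP => Phi0.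
(* Rescaling [f] makes the functional equal to 1 while keeping the zeros on [s], against the bound
   [sPhi]. *)
have ca : continuous (fun x => (Phi f y)^-1 * f x + 0).
  move=> x; apply: cvgD; last exact: cvg_cst.
  by apply: cvgM; [exact: cvg_cst|exact: cf].
have f0' : {in s, forall x, (Phi f y)^-1 * f x + 0 = 0}.
  by move=> x xs; rewrite f0// mulr0 addr0.
have := sPhi _ f0' ca.
rewrite /= lin// Phi00 addr0 mulVf ?normr1 ?ltxx//.
by rewrite -normr_gt0.
Qed.

(* If [x] is removed from a minimal [s], some [f] vanishing on the rest of [s]
   has [lam f <> 0]; multiplying [f] by a bump at [x] does not change its values
   on [s]. *)
Lemma determining_bump (R : realType) (K : topologicalType)
    (lam : (K -> R) -> R) (s : seq K) (x : K) (V : set K) :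
  compact_hausdorff K -> linear_on_Cp lam ->
  determining lam s -> ~ determining lam (rem x s) -> uniq s -> nbhs x V ->
  exists g : K -> R, [/\ continuous g, forall z, ~ V z -> g z = 0 & lam g <> 0].
Proof.
move=> chK lin ds /existsNP[f /not_implyP[cf /not_implyP[f0 lf]]] us xV.
have [h [ch _ hx hV]] := @compact_hausdorff_bump R K x V chK xV.
have cfh : continuous (fun z => f z * h z).
  by move=> z; apply: cvgM; [exact: cf|exact: ch].
exists (fun z => f z * h z); split => // [z nVz|lfh].
  by rewrite hV// mulr0.
apply: lf; have <- : -1 * lam (fun z => f z * h z) + lam f = lam f.
  by rewrite lfh mulr0 add0r.
rewrite -lin//; apply: ds.
  move=> z; apply: cvgD; last exact: cf.
  by apply: cvgM; [exact: cvg_cst|exact: cfh].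
move=> z zs; have [->|zx] := eqVneq z x; first by rewrite hx; lra.
by rewrite f0 ?mem_rem_uniq ?inE ?zx// mul0r mulr0 addr0.
Qed.

Lemma minimal_determining (R : realType) (K : topologicalType)
    (lam : (K -> R) -> R) :
  (exists s, determining lam s) ->
  exists s, [/\ uniq s, determining lam s &
    forall t, determining lam t -> (size s <= size t)%N].
Proof.
move=> [s0 ds0].
have ex : exists n, `[< exists2 s, size s = n & determining lam s >].
  by exists (size s0); apply/asboolP; exists s0.
case: (ex_minnP ex) => n /asboolP[s sn ds] nmin.
have smin t : determining lam t -> (size s <= size t)%N.
  by move=> dt; rewrite sn; apply: nmin; apply/asboolP; exists t.
have dus : determining lam (undup s).
  by move=> f cf f0; apply: ds => // x xs; apply: f0; rewrite mem_undup.
exists s; split => //; rewrite -[uniq s]negbK -ltn_size_undup -leqNgt.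
exact: smin.
Qed.

Lemma minimal_not_determining (R : realType) (K : topologicalType)
    (lam : (K -> R) -> R) (s : seq K) :
  (forall t, determining lam t -> (size s <= size t)%N) ->
  forall x, x \in s -> ~ determining lam (rem x s).
Proof.
move=> smin x xs /smin; rewrite size_rem// leqNgt ltn_predL.
by case: s xs {smin}.
Qed.

(** A function [g] vanishing off [V] with [lam y g] nonzero keeps [lam y' g] nonzero for [y'] near
    [y]; a determining set missing [V] would force it to be 0. *)
Lemma near_determining_meets (R : realType) (K L : topologicalType)
    (lam : L -> (K -> R) -> R) (y : L) (s : seq K) (x : K) (V : set K) :
  compact_hausdorff K -> (forall y, linear_on_Cp (lam y)) ->
  (forall f : K -> R, continuous f -> continuous (lam ^~ f)) ->
  uniq s -> determining (lam y) s -> ~ determining (lam y) (rem x s) ->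
  nbhs x V ->
  \forall y' \near y, forall t, determining (lam y') t ->
    exists2 p, p \in t & V p.
Proof.
move=> chK lin clam us ds nds xV.
have [g [cg gV lg]] := determining_bump R K _ s x V chK (lin y) ds nds us xV.
have : \forall y' \near y, lam y' g != 0.
  by apply: cvgr_neq0 (clam g cg y) _; exact/eqP.
apply: filterS => y' /eqP lg' t dt; apply: contrapT => noV; apply: lg'.
apply: dt => // z zt; apply: gV => Vz; apply: noV.
by exists z.
Qed.

(** * From local countability to countability of the index space *)

Lemma second_countable_locally_countable (L : topologicalType) (D : set L) :
  @second_countable L ->
  (forall y, D y -> exists2 V, nbhs y V & countable (D `&` V)) -> countable D.
Proof.
move=> [B cB [Bo Bb]] locD.
pose G := B `&` [set V | countable (D `&` V)].
have : countable (\bigcup_(V in G) (D `&` V)).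
  apply: bigcup_countable => [|V []//].
  by apply: sub_countable cB; apply: subset_card_le => V [].
apply: sub_countable; apply: subset_card_le => y Dy.
have [V yV cDV] := locD y Dy; have [W [BW Wy] WV] := Bb y V yV.
exists W => //; split => //; apply: sub_countable cDV.
by apply: subset_card_le; exact: setIS.
Qed.

Section countable_domain.
Variables (R : realType) (K L : topologicalType) (lam : L -> (K -> R) -> R).
Variables (t : L -> seq K) (r : K -> seq L).
Hypothesis chK : compact_hausdorff K.
Hypothesis chL : compact_hausdorff L.
Hypothesis scL : @second_countable L.
Hypothesis lin : forall y, linear_on_Cp (lam y).
Hypothesis clam : forall f : K -> R, continuous f -> continuous (lam ^~ f).
Hypothesis ut : forall y, uniq (t y).
Hypothesis dt : forall y, determining (lam y) (t y).
Hypothesis mint : forall y s, determining (lam y) s -> (size (t y) <= size s)%N.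
Hypothesis tr : forall y, exists2 p, p \in t y & y \in r p.
Hypothesis imK : forall (M : set L) (g : L -> K), compact M ->
  {within M, continuous g} -> countable (g @` M).

Let lsc (y : L) (U : K -> set K) : (forall z, z \in t y -> nbhs z (U z)) ->
  \forall y' \near y, forall z, z \in t y -> exists2 p, p \in t y' & U z p.
Proof.
move=> nU; have : \forall y' \near y, 
    (\bigcap_(z in [set` [fset z in t y]%fset])
    [set y' | exists2 p, p \in t y' & U z p]) y'.
  apply: filter_bigI => z; rewrite !inE => zt.
  have := @near_determining_meets R K L lam y (t y) z (U z) chK lin clam (ut y)
    (dt y) (minimal_not_determining R K _ _ (mint y) z zt) (nU z zt).
  by apply: filterS => y' /(_ _ (dt y')).
by apply: filterS => y' meet z zt; apply: meet; rewrite /= !inE.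
Qed.

(** One point of [t y'] in each of the disjoint neighbourhoods of the points of [t y] gives an
    injection of [t y] into [t y'] for [y'] near [y]. *)
Let closed_size n : closed [set y | (size (t y) <= n)%N].
Proof.
rewrite -[X in closed X]setCK; apply: open_closedC.
rewrite openE => y /= /negP; rewrite -ltnNge => nty.
have [hK _] := chK.
have [U [oU Uz Usep]] := hausdorff_disjoint_nbhs K (t y) hK.
have := lsc y U (fun z _ => open_nbhs_nbhs (conj (oU z) (Uz z))).
apply: filterS => y' meet /=; apply/negP; rewrite -ltnNge.
apply: leq_trans nty _.
have /choice[h hP] : forall z, exists p, z \in t y -> p \in t y' /\ U z p.
  move=> z; have [zt|_] := boolP (z \in t y); last by exists z.
  by have [p] := meet z zt; exists p.
rewrite -(size_map h); apply: uniq_leq_size.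
  rewrite map_inj_in_uniq// => z w zt wt hzw; apply: Usep => //.
  by exists (h z); split; [|rewrite hzw]; apply: (hP _ _).2.
by move=> _ /mapP[z zt ->]; have [] := hP z zt.
Qed.

Let countable_piece (y0 : L) (n := size (t y0)) :
  exists2 W, nbhs y0 W & countable ([set y | (size (t y) <= n)%N] `&` W).
Proof.
have [hK _] := chK; have [hL cL] := chL.
have [U [oU Uz Usep]] := hausdorff_disjoint_nbhs K (t y0) hK.
have nU := lsc y0 U (fun z _ => open_nbhs_nbhs (conj (oU z) (Uz z))).
(* Regularity gives a closed neighbourhood on which [t y] still meets every [U z]. *)
have [W yW WU] := compact_regular hL cL filterT nU.
exists (closure W); first by apply: filterS yW; exact: subset_closure.
set M := _ `&` _.
have cM : compact M.
  apply: (subclosed_compact _ cL) => //; apply: closedI => //.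
  exact: closed_closure.
have /choice[h hP] : forall zy, exists p,
    zy.1 \in t y0 -> M zy.2 -> p \in t zy.2 /\ U zy.1 p.
  move=> [z y] /=; have [[zt My]|zy] := pselect (z \in t y0 /\ M y).
    by have [p] := WU y My.2 z zt; exists p.
  by exists z => zt My; exfalso; apply: zy.
pose x z y := h (z, y).
have xP z y : z \in t y0 -> M y -> x z y \in t y /\ U z (x z y).
  exact: (hP (z, y)).
(* The points [x z y] are distinct since the [U z] are disjoint, and [t y] is no longer than [t y0],
   so they exhaust [t y]. *)
have xt y : M y -> forall p, p \in t y -> exists2 z, z \in t y0 & p = x z y.
  move=> My p pt; suff : p \in [seq x z y | z <- t y0] by move=> /mapP.
  have [|||_ ->] := @uniq_min_size _ [seq x z y | z <- t y0] (t y) => //.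
  - rewrite map_inj_in_uniq// => z w zt wt xzw; apply: Usep => //.
    by exists (x z y); split; [|rewrite xzw]; apply: (xP _ _ _ My).2.
  - by move=> _ /mapP[z zt ->]; have [] := xP z y zt My.
  - by rewrite size_map; exact: My.1.
(* Near [y] the set [t y'] meets [V] within [U z]; by disjointness the point found there can only be
   [x z y']. *)
have cx z : z \in t y0 -> {within M, continuous (x z)}.
  move=> zt; apply/subspace_continuousP => y My V xV.
  have [xty Ux] := xP z y zt My.
  have xVU : nbhs (x z y) (V `&` U z).
    by apply: filterI => //; apply: open_nbhs_nbhs.
  have := @near_determining_meets R K L lam y (t y) _ _ chK lin clam (ut y)
    (dt y) (minimal_not_determining R K _ _ (mint y) _ xty) xVU.
  apply: filterS => y' /(_ _ (dt y'))[p pt [Vp Up]] My'.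
  have [w wt pw] := xt y' My' p pt.
  suff wz : w = z by rewrite pw wz in Vp.
  apply: Usep => //; exists p; split => //.
  by rewrite pw; have [] := xP w y' wt My'.
(* By [tr] every [y] in [M] lies in [r p] for some [p] in [t y], and [p] is in the range of one of
   the finitely many maps [x z]. *)
have : countable
    (\bigcup_(z in [set` t y0]) \bigcup_(p in x z @` M) [set` r p]).
  apply: bigcup_countable => [|z zt].
    exact: finite_set_countable.
  apply: bigcup_countable => [|p _]; first exact/imK/cx.
  exact: finite_set_countable.
apply: sub_countable; apply: subset_card_le => y My.
have [p pt yp] := tr y; have [z zt pz] := xt y My p pt.
by exists z => //; exists p => //; exists y.
Qed.

Lemma countable_domain : countable [set: L].
Proof.
have -> : [set: L] = \bigcup_n [set y | size (t y) = n].
  by apply/esym; rewrite -subTset => y _; exists (size (t y)).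
apply: bigcup_countable => // n _.
apply: second_countable_locally_countable => // y <-.
have [W yW cW] := countable_piece y; exists W => //.
apply: sub_countable cW; apply: subset_card_le; apply: setSI => z /= ->.
exact: leqnn.
Qed.
End countable_domain.

(** * Products, linearity of the projection, and the theorem *)

Lemma compact_hausdorff_prod (K1 K2 : topologicalType) :
  compact_hausdorff K1 -> compact_hausdorff K2 ->
  compact_hausdorff (K1 * K2)%type.
Proof.
move=> [h1 c1] [h2 c2]; split; last by rewrite -setXTT; exact: compact_setX.
move=> [p1 p2] [q1 q2] pq; congr pair.
  apply: h1 => A B Ap Bq.
  have [] := pq (fst @^-1` A) (fst @^-1` B).
  - by exists (A, setT) => [|[? ?] []//]; split => //; exact: filterT.
  - by exists (B, setT) => [|[? ?] []//]; split => //; exact: filterT.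
  - by move=> x ABx; exists x.1.
apply: h2 => A B Ap Bq.
have [] := pq (snd @^-1` A) (snd @^-1` B).
- by exists (setT, A) => [|[? ?] []//]; split => //; exact: filterT.
- by exists (setT, B) => [|[? ?] []//]; split => //; exact: filterT.
- by move=> x ABx; exists x.2.
Qed.

(** The image lies in the product of its two coordinate projections, each closed and metrizable in
    its factor and therefore countable. *)
Lemma countable_image_prod (R : realType) (K1 K2 L : topologicalType)
    (M : set L) (g : L -> K1 * K2) :
  @second_countable L -> compact_hausdorff K1 -> compact_hausdorff K2 ->
  ~ has_uncountable_metrizable_closed R K1 ->
  ~ has_uncountable_metrizable_closed R K2 ->
  compact M -> {within M, continuous g} -> countable (g @` M).
Proof.
move=> scL chK1 chK2 nK1 nK2 cM cg.
have ctb (T : topologicalType) (p : K1 * K2 -> T) : continuous p ->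
    compact_hausdorff T -> ~ has_uncountable_metrizable_closed R T ->
    countable ((p \o g) @` M).
  move=> cp chT nT; apply: contrapT => nc; apply: nT; exists ((p \o g) @` M).
  have [|//] := continuous_image_metrizable R L T M (p \o g) scL chT cM.
  by move=> y; exact: (@continuous_comp (subspace M) _ _ g p y (cg y) (cp _)).
have c1 : continuous (@fst K1 K2) by move=> x; exact: cvg_fst.
have c2 : continuous (@snd K1 K2) by move=> x; exact: cvg_snd.
have := countableX (ctb K1 fst c1 chK1 nK1) (ctb K2 snd c2 chK2 nK2).
apply: sub_countable; apply: subset_card_le => _ [y My <-].
by split; exists y.
Qed.

(** The difference [u] of the two sides lies in [E], and by the decomposition also in [F], so it
    vanishes. *)
Lemma complement_projection_linear (R : realType) (K : topologicalType)
  (E F : set {ptws K -> R}) (pE pF : {ptws K -> R} -> {ptws K -> R}) :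
  linear_subspace R K E -> linear_subspace R K F ->
  E `&` F = [set (fun _ => 0)] ->
  (forall f, Cp R K f ->
    [/\ E (pE f), F (pF f) & f = (fun x => pE f x + pF f x)]) ->
  forall a f g, Cp R K f -> Cp R K g -> Cp R K (fun x => a * f x + g x) ->
  pE (fun x => a * f x + g x) = (fun x => a * pE f x + pE g x).
Proof.
move=> [_ lE] [_ lF] EF dec a f g cf cg ch.
have [Ef Ff fE] := dec f cf; have [Eg Fg gE] := dec g cg.
have [Eh Fh hE] := dec _ ch.
pose u x := -1 * pE (fun x => a * f x + g x) x + (a * pE f x + pE g x).
have Eu : E u by apply: (lE) => //; exact: lE.
have Fu : F u.
  have -> : u = (fun x => -1 * (a * pF f x + pF g x) +
                          pF (fun x => a * f x + g x) x).
    apply/funext => x; rewrite /u.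
    have := congr1 (@^~ x) hE; rewrite /= {1}fE {1}gE; lra.
  by apply: (lF) => //; exact: lF.
have : (E `&` F) u by [].
rewrite EF => u0; apply/funext => x.
by have := congr1 (@^~ x) u0; rewrite /u /=; lra.
Qed.

Theorem theorem1p6 (R : realType) (K1 K2 : topologicalType) :
  compact_hausdorff K1 -> compact_hausdorff K2 ->
  ~ has_uncountable_metrizable_closed R K1 ->
  ~ has_uncountable_metrizable_closed R K2 ->
  forall L : topologicalType, uncountable_metric_compact R L ->
  ~ Cp_contains_complemented_Cp R (K1 * K2)%type L.
Proof.
move=> chK1 chK2 nK1 nK2 L [mL cL ncL].
move=> [E [F [pE [pF [EK [FK [lE [lF [_ [_ [EF [dec [cpE [_]]]]]]]]]]]]]].
move=> [phi [psi [phiL [psiE [psiK [phiK [linphi [cphi cpsi]]]]]]]]; apply: ncL.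
set K := (K1 * K2)%type in E F pE pF EK FK lE lF EF dec cpE phi psi phiL psiE
  psiK phiK linphi cphi cpsi *.
have chK : compact_hausdorff K by exact: compact_hausdorff_prod.
have hL : hausdorff_space L := metrizable_hausdorff R L mL.
have chL : compact_hausdorff L by [].
have scL : @second_countable L.
  exact: metrizable_compact_second_countable mL cL.
have cl (T : topologicalType) a (f g : T -> R) : continuous f -> continuous g ->
    continuous (fun x => a * f x + g x).
  move=> cf cg x; apply: cvgD; last exact: cg.
  by apply: cvgM; [exact: cvg_cst|exact: cf].
have pEE f : continuous f -> E (pE f) by move=> /dec[].
(* [Phi] is a left inverse of [psi] defined on all of C_p(K). *)
pose Phi f : {ptws L -> R} := phi (pE f).
have linPhi y : linear_on_Cp (fun f : K -> R => Phi f y).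
  move=> a f g cf cg; rewrite /Phi.
  rewrite (complement_projection_linear R K E F pE pF)//; last exact: cl.
  by rewrite linphi//; exact: pEE.
have cPhi : {within Cp R K, continuous Phi}.
  apply/subspace_continuousP => f cf V nV.
  have /subspace_continuousP/(_ _ (pEE f cf) V nV) phiV := cphi.
  have /subspace_continuousP/(_ f cf _ phiV) pEV := cpE.
  refine (@filterS _ (nbhs (f : {ptws K -> R})) (nbhs_filter _) _ _ _ pEV).
  by move=> g /= + cg; apply => //; exact: pEE.
(* Linearity is assumed for [phi] only; it passes to the inverse [psi] because [E] is a subspace. *)
have linPsi p : linear_on_Cp (fun g : L -> R => psi g p).
  move=> a f g cf cg; have := lE.2 a _ _ (psiE f cf) (psiE g cg).
  move=> /psiK; rewrite linphi; [|exact: psiE|exact: psiE].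
  by rewrite !phiK// => ->.
(* For [f] in [E] the remainder [pF f] lies in both [E] and [F]. *)
have pEid f : E f -> pE f = f.
  move=> Ef; have cf : continuous f := EK f Ef.
  have [EpE FpF fE] := dec f cf.
  have pFE : pF f = (fun x => -1 * pE f x + f x).
    by apply/funext => x; have /= := congr1 (@^~ x) fE; lra.
  have : (E `&` F) (pF f) by split => //; rewrite pFE; exact: lE.2.
  rewrite EF /= => pF0; apply/funext => x.
  by have /= := congr1 (@^~ x) fE; rewrite pF0 addr0.
have Phipsi g : continuous g -> Phi (psi g) = g.
  by move=> cg; rewrite /Phi pEid ?phiK//; exact: psiE.
have dPhi := continuous_determining R K L Phi cPhi linPhi.
have /choice[r dr] := continuous_determining R L K psi cpsi linPsi.
have /choice[t tP] := fun y => minimal_determining R K _ (dPhi y).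
apply: (@countable_domain R K L (fun y f => Phi f y) t r) => //.
- move=> f cf; apply: phiL; exact: pEE.
- by move=> y; have [] := tP y.
- by move=> y; have [] := tP y.
- by move=> y; have [] := tP y.
- move=> y; have [ut dt mt] := tP y.
  (* If [y] avoids the finite set [Z], take [g] equal to 1 at [y] and 0 on [Z]. Then [psi g]
     vanishes on [t y], so [Phi (psi g)], which is [g], would vanish at [y]. *)
  apply: contrapT => nyr; pose Z := [set` flatten [seq r p | p <- t y]].
  have cZ : closed Z.
    have /accessible_finite_set_closed := hausdorff_accessible hL.
    by apply; exact: finite_seq.
  have [|g [cg _ gy gZ]] := compact_hausdorff_bump R L y (~` Z) chL.
    apply: open_nbhs_nbhs; split; first exact: closed_openC.
    move=> /flattenP[_ /mapP[p pt ->] yrp]; apply: nyr.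
    by exists p.
  have psig0 : {in t y, forall p, psi g p = 0}.
    move=> p pt; apply: dr => // z zr; apply: gZ; apply.
    by apply/flattenP; exists (r p) => //; apply/mapP; exists p.
  have := dt _ (EK _ (psiE g cg)) psig0.
  by rewrite Phipsi// gy; apply/eqP; rewrite oner_eq0.
- by move=> M g cM cg; exact: (countable_image_prod R K1 K2 L M g).
Qed.
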